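(* Let a prior network with boundary conditions, positive weights $d_{kl}$ and a material amount $K>0$ be given, and suppose all pressure vertices have the same prescribed pressure. Let $(\kappa_{kl})$ be a physical network with $\sum_{k>l,\langle k,l\rangle=1}\kappa_{kl}^{1/2}d_{kl}=K$ that globally minimizes the dissipation $$D=\sum_{k>l,\langle k,l\rangle=1}\frac{Q_{kl}^2}{\kappa_{kl}}$$ among all physical networks satisfying this material constraint, where $Q_{kl}$ denotes the Kirchhoff flow of the network. Then: (i) the network satisfies Murray's law: there is a constant $a>0$ such that $\kappa_{kl}=a\,|Q_{kl}|^{4/3}/d_{kl}^{2/3}$ for all $\langle k,l\rangle=1$; (ii) the network has no loops; (iii) the network has no path connecting two pressure vertices.
   Context: Prior network: a finite simple undirected graph on vertices $1,\dots,V$; $\langle k,l\rangle=1$ means $k,l$ are joined by an edge ($\langle k,l\rangle=\langle l,k\rangle$), and $\langle k,l\rangle=0$ otherwise. Each edge carries a fixed weight $d_{kl}=d_{lk}>0$. Boundary conditions: disjoint vertex sets $\mathcal P$ (pressure vertices, each with prescribed pressure $\bar p_k\in\mathbb R$) and $\mathcal F$ (flow vertices, each with prescribed inflow $q_k\in\mathbb R$). Put $q_k=0$ for $k\notin\mathcal P\cup\mathcal F$. A network is a choice of conductances $\kappa_{kl}=\kappa_{lk}\ge 0$ on the edges. A Kirchhoff flow is $Q_{kl}=(p_k-p_l)\kappa_{kl}$ on the edges (so $Q_{kl}=-Q_{lk}$), where the pressures $p_k$ satisfy $p_k=\bar p_k$ for $k\in\mathcal P$ and $\sum_{l:\langle k,l\rangle=1}(p_k-p_l)\kappa_{kl}=q_k$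 for $k\notin\mathcal P$. The network is physical if there is exactly one Kirchhoff flow (equivalently, every connected component of the graph formed by all vertices and the edges with $\kappa_{kl}>0$ contains a vertex of $\mathcal P$ or has total prescribed inflow zero). Convention: a term $Q_{kl}^2/\kappa_{kl}$ with $\kappa_{kl}=0$ and $Q_{kl}=0$ is $0$. A path between two different vertices $k$ and $l$ is a sequence of pairwise distinct vertices $k=k_1,k_2,\dots,k_n=l$ with $\langle k_i,k_{i+1}\rangle=1$ and $\kappa_{k_ik_{i+1}}>0$ for all $1\le i\le n-1$. A loop is a sequence of pairwise distinct vertices $k_1,\dots,k_n$, $n\ge 3$, with $\langle k_i,k_{i+1}\rangle=1$ and $\kappa_{k_ik_{i+1}}>0$ for all $1\le i\le n$, where $k_{n+1}=k_1$.
   Formalization: The formal theorem additionally assumes that some flow vertex has a nonzero prescribed inflow; if all inflows vanish, every Kirchhoff flow is zero and every admissible network is a minimizer, while K > 0 forces some positive conductance, so Murray's law (i) fails. *)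

(* Defs.v *)
From mathcomp Require Import all_boot all_order all_algebra.
From mathcomp Require Import all_classical all_reals all_analysis.

Set Implicit Arguments.
Unset Strict Implicit.
Unset Printing Implicit Defensive.

Import Order.TTheory GRing.Theory Num.Theory.

Local Open Scope ring_scope.

(* Edge quantities (weights [d], conductances [kappa]) are matrices of which
   only the entries on edges of [adj] are meaningful. *)

Section Networks.

Context {R : realType} {V : nat}.

Implicit Types (adj : rel 'I_V) (d kappa Q : 'M[R]_V) (P : {set 'I_V}).
Implicit Types (pbar q p : 'I_V -> R).

Definition is_network adj kappa : Prop :=
  forall k l, adj k l -> kappa k l = kappa l k /\ 0 <= kappa k l.

Definition is_pressure adj P pbar q kappa p : Prop :=
  (forall k, k \in P -> p k = pbar k) /\
  (forall k, k \notin P -> \sum_(l | adj k l) (p k - p l) * kappa k l = q k).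

(* A flow lives on the edges; extending it by 0 off the edges makes equality of
   matrices the same as equality of flows. *)
Definition is_kirchhoff_flow adj P pbar q kappa Q : Prop :=
  exists2 p, is_pressure adj P pbar q kappa p &
    Q = \matrix_(k, l) (if adj k l then (p k - p l) * kappa k l else 0).

Definition is_physical adj P pbar q kappa : Prop :=
  exists! Q, is_kirchhoff_flow adj P pbar q kappa Q.

Definition material adj d kappa : R :=
  \sum_(k < V) \sum_(l < V | (l < k)%N && adj k l) Num.sqrt (kappa k l) * d k l.

(* Since 0^-1 = 0, a term with [kappa k l = 0] and [Q k l = 0] is 0. *)
Definition dissipation adj kappa Q : R :=
  \sum_(k < V) \sum_(l < V | (l < k)%N && adj k l) Q k l ^+ 2 / kappa k l.

Definition is_admissible adj P pbar q d (K : R) kappa : Prop :=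
  [/\ is_network adj kappa, is_physical adj P pbar q kappa
    & material adj d kappa = K].

Definition is_minimizer adj P pbar q d (K : R) kappa : Prop :=
  is_admissible adj P pbar q d K kappa /\
  forall kappa' Q Q',
    is_admissible adj P pbar q d K kappa' ->
    is_kirchhoff_flow adj P pbar q kappa Q ->
    is_kirchhoff_flow adj P pbar q kappa' Q' ->
    dissipation adj kappa Q <= dissipation adj kappa' Q'.

Definition conducts adj kappa : rel 'I_V :=
  fun k l => adj k l && (0 < kappa k l).

(* The vertex sequence of the path is [k :: s]. *)
Definition is_path adj kappa (k l : 'I_V) (s : seq 'I_V) : bool :=
  [&& k != l, uniq (k :: s), path (conducts adj kappa) k s & last k s == l].

Definition is_loop adj kappa (s : seq 'I_V) : bool :=
  [&& uniq s, (3 <= size s)%N & cycle (conducts adj kappa) s].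

End Networks.

(* Main.v *)
Require Import Defs.
From mathcomp Require Import all_boot all_order all_algebra.
From mathcomp Require Import all_classical all_reals all_analysis.
From mathcomp Require Import ring lra.

Set Implicit Arguments.
Unset Strict Implicit.
Unset Printing Implicit Defensive.

Import Order.TTheory GRing.Theory Num.Theory.

Local Open Scope ring_scope.

(* With constant boundary pressure, Thomson's principle says that the Kirchhoff
   flow of a network minimizes sum X^2 / kappa among all flows X with the
   prescribed inflows.  For a given flow X the best conductances are those of
   Murray's law, with dissipation f(X)^3 / K^2 where
   f(X) = sum (|X| d)^(2/3), and they form a physical network because they
   carry X.  Hence the minimizer is Murray's network for its own flow Q, and Q
   minimizes f.  Since f is concave, strictly so in the directions supported on
   conducting edges, no nonzero flow on those edges can be free of sources
   outside P; a loop or a path between two pressure vertices would carry one. *)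

(** Every undirected edge is counted once, larger endpoint first, in agreement with the double sums
    of [material] and [dissipation]. *)
Definition edge (V : nat) (adj : rel 'I_V) : pred ('I_V * 'I_V) :=
  fun e => (e.2 < e.1)%N && adj e.1 e.2.

(** The competitors in Thomson's principle: such a flow need not come from pressures. *)
Definition is_flow (R : realType) (V : nat) (adj : rel 'I_V) (P : {set 'I_V})
    (q : 'I_V -> R) (X : 'M[R]_V) : Prop :=
  [/\ forall k l, X l k = - X k l,
      forall k l, ~~ adj k l -> X k l = 0
    & forall k, k \notin P -> \sum_(l | adj k l) X k l = q k].

(** * Kirchhoff flows: uniqueness and solvability with zero boundary pressure *)

Section Flows.

Context {R : realType} {V : nat}.
Context (adj : rel 'I_V) (adj_sym : symmetric adj) (adj_irr : irreflexive adj).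
Context (P : {set 'I_V}).

Implicit Types (kappa X C Q d : 'M[R]_V) (q p u : 'I_V -> R).

Lemma edge_sumE (F : 'I_V -> 'I_V -> R) :
  \sum_(k < V) \sum_(l < V | (l < k)%N && adj k l) F k l =
  \sum_(e | edge adj e) F e.1 e.2.
Proof. by rewrite pair_big_dep. Qed.

Lemma materialE d kappa :
  material adj d kappa =
  \sum_(e | edge adj e) Num.sqrt (kappa e.1 e.2) * d e.1 e.2.
Proof. exact: edge_sumE. Qed.

Lemma dissipationE kappa X :
  dissipation adj kappa X =
  \sum_(e | edge adj e) X e.1 e.2 ^+ 2 / kappa e.1 e.2.
Proof. exact: (edge_sumE (fun k l => X k l ^+ 2 / kappa k l)). Qed.

Lemma edge_adj e : edge adj e -> adj e.1 e.2.
Proof. by case/andP. Qed.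

Lemma adj_edge k l : adj k l -> edge adj (k, l) \/ edge adj (l, k).
Proof.
move=> kl; rewrite /edge /= (adj_sym l) kl !andbT.
case: (ltngtP k l) => [||/val_inj eqkl]; [by right|by left|].
by rewrite eqkl adj_irr in kl.
Qed.

(** Each edge appears once from either endpoint, and antisymmetry merges the two terms into a
    potential difference; irreflexivity excludes the diagonal. *)
Lemma sum_by_parts u (X : 'I_V -> 'I_V -> R) :
  (forall k l, adj k l -> X l k = - X k l) ->
  \sum_k u k * \sum_(l | adj k l) X k l =
  \sum_(e | edge adj e) (u e.1 - u e.2) * X e.1 e.2.
Proof.
move=> Xanti.
pose g k l := u k * X k l.
transitivity (\sum_k \sum_(l | adj k l) g k l).
  by apply: eq_bigr => k _; rewrite mulr_sumr.
transitivity (\sum_(k < V) \sum_(l < V | (l < k)%N && adj k l) g k l +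
              \sum_(k < V) \sum_(l < V | (k < l)%N && adj k l) g k l).
  rewrite -big_split /=; apply: eq_bigr => k _.
  rewrite (bigID (fun l : 'I_V => (l < k)%N)) /=; congr (_ + _).
    by apply: eq_bigl => l; rewrite andbC.
  apply: eq_bigl => l; rewrite -leqNgt andbC.
  case: ltngtP => // /val_inj ->; exact: adj_irr.
rewrite [X in _ + X](exchange_big_dep predT) //= -big_split /=.
rewrite -(edge_sumE (fun k l => (u k - u l) * X k l)).
apply: eq_bigr => k _.
have swap (l : 'I_V) : (l < k)%N && adj l k =
    (l < k)%N && adj k l by rewrite adj_sym.
rewrite [X in _ + X](eq_bigl _ _ swap).
rewrite -big_split; apply: eq_bigr => l /andP[_ kl] /=.
by rewrite /g (Xanti _ _ kl) mulrBl mulrN.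
Qed.

Lemma kirchhoff_is_flow pbar q kappa X :
  is_network adj kappa -> is_kirchhoff_flow adj P pbar q kappa X ->
  is_flow adj P q X.
Proof.
move=> net [p [_ pq] ->]; split.
- move=> k l; rewrite !mxE (adj_sym l).
  by case: ifP => [/net[-> _]|_]; rewrite ?oppr0 // -mulNr opprB.
- by move=> k l /negbTE nkl; rewrite mxE nkl.
- by move=> k /pq <-; apply: eq_bigr => l kl; rewrite mxE kl.
Qed.

Lemma flow_perturb q X C t :
  is_flow adj P q X -> is_flow adj P (fun=> 0) C ->
  is_flow adj P q (X + t *: C).
Proof.
move=> [Xa Xs Xd] [Ca Cs Cd]; split.
- by move=> k l; rewrite !mxE Xa Ca mulrN opprD.
- by move=> k l nkl; rewrite !mxE Xs // Cs // mulr0 addr0.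
- move=> k kP; under eq_bigr do rewrite !mxE.
  by rewrite big_split /= -mulr_sumr Xd // Cd // mulr0 addr0.
Qed.

Lemma potential_flow_anti kappa u :
  is_network adj kappa ->
  forall k l, adj k l -> (u l - u k) * kappa l k = - ((u k - u l) * kappa k l).
Proof. by move=> net k l /net[-> _]; rewrite -mulNr opprB. Qed.

(** Energy argument: summing [u] against its own net outflow by parts gives the sum of
    [kappa * (u k - u l) ^+ 2], which is therefore 0 term by term. *)
Lemma harmonic_flow_eq0 kappa u :
  is_network adj kappa -> is_pressure adj P (fun=> 0) (fun=> 0) kappa u ->
  forall k l, adj k l -> (u k - u l) * kappa k l = 0.
Proof.
move=> net [u0 uh].
have E : \sum_(e | edge adj e) (u e.1 - u e.2) *
    ((u e.1 - u e.2) * kappa e.1 e.2) = 0.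
  rewrite -(sum_by_parts _ (X := fun k l => (u k - u l) * kappa k l));
    last exact: potential_flow_anti.
  apply: big1 => k _; have [/u0 ->|/uh ->] := boolP (k \in P).
    exact: mul0r.
  exact: mulr0.
have edge0 e : edge adj e -> (u e.1 - u e.2) * kappa e.1 e.2 = 0.
  move=> ee; have := psumr_eq0P _ E ee => H.
  have {}H : (u e.1 - u e.2) * ((u e.1 - u e.2) * kappa e.1 e.2) = 0.
    apply: H => i /edge_adj/net[_ k0].
    by rewrite mulrA -expr2 mulr_ge0 ?sqr_ge0.
  by move/eqP: H; rewrite mulf_eq0 => /orP[/eqP->|/eqP //]; rewrite mul0r.
move=> k l kl; have [/edge0 //|/edge0 /= lk] := adj_edge kl.
by rewrite -[LHS]opprK -(potential_flow_anti u net) // lk oppr0.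
Qed.

Lemma kirchhoff_unique pbar q kappa X Y :
  is_network adj kappa -> is_kirchhoff_flow adj P pbar q kappa X ->
  is_kirchhoff_flow adj P pbar q kappa Y -> X = Y.
Proof.
move=> net [p [pb pq] ->] [p' [pb' pq'] ->].
apply/matrixP => k l; rewrite !mxE; case: ifP => // kl.
apply/eqP; rewrite -subr_eq0 -mulrBl.
have -> : p k - p l - (p' k - p' l) = (p k - p' k) - (p l - p' l) by ring.
apply/eqP.
apply: (@harmonic_flow_eq0 kappa (fun i => p i - p' i)) => //; split.
  by move=> i iP; rewrite pb // pb' // subrr.
move=> i iP; rewrite -[RHS](subrr (q i)) -{1}(pq _ iP) -(pq' _ iP) -sumrB.
by apply: eq_bigr => j _; ring.
Qed.

(** Fredholm alternative for the grounded Laplacian. A kernel vector has no drop across a conducting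
    edge, and [X] vanishes on the other edges, so summation by parts against [X] shows the kernel
    orthogonal to the right-hand side. *)
Lemma dirichlet_solvable q kappa X :
  is_network adj kappa -> is_flow adj P q X ->
  (forall k l, adj k l -> kappa k l = 0 -> X k l = 0) ->
  exists u, is_pressure adj P (fun=> 0) q kappa u.
Proof.
move=> net [Xa Xs Xd] Xk.
pose L k l := (k == l)%:R * (\sum_(m | adj k m) kappa k m)
              - (if adj k l then kappa k l else 0).
(* Columns in [P] are cleared as well as rows; zero boundary values make this harmless, and [A]
   becomes symmetric. *)
pose A : 'M[R]_V := \matrix_(k, l)
  if k \in P then (k == l)%:R else if l \in P then 0 else L k l.
pose b : 'rV[R]_V := \row_k if k \in P then 0 else q k.
have LE u k : \sum_l L k l * u l = \sum_(l | adj k l) (u k - u l) * kappa k l.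
  under eq_bigr do rewrite mulrBl.
  rewrite sumrB (bigD1 k) //= eqxx mul1r.
  rewrite [X in _ + X - _]big1 ?addr0; last first.
    by move=> l; rewrite eq_sym => /negbTE ->; rewrite !mul0r.
  rewrite mulr_suml [X in _ - X](bigID (adj k)) /=.
  rewrite [X in _ - (_ + X)]big1 ?addr0; last first.
    by move=> l /negbTE ->; rewrite mul0r.
  rewrite -sumrB; apply: eq_bigr => l ->; ring.
have AE u : (forall k, k \in P -> u k = 0) -> forall k,
    \sum_l A k l * u l =
    if k \in P then 0 else \sum_(l | adj k l) (u k - u l) * kappa k l.
  move=> u0 k; case: ifP => kP.
    apply: big1 => l _; rewrite mxE kP.
    by have [<-|_] := eqVneq k l; rewrite ?mul0r // u0 ?mulr0.
  rewrite -LE; apply: eq_bigr => l _; rewrite mxE kP.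
  by case: ifP => // /u0 ->; rewrite !mulr0.
have Asym : A^T = A.
  apply/matrixP => k l; rewrite !mxE.
  have [->//|kl] := eqVneq k l.
  rewrite /L eq_sym (negbTE kl) !mul0r !sub0r adj_sym.
  by do 2![case: ifP => //]; case: ifP => // /net[->].
(* The hypothesis constrains only the rows in [P], where it says that the product vanishes. *)
have AP (u : 'I_V -> R) : (forall k, \sum_l A k l * u l = 
      if k \in P then 0 else \sum_l A k l * u l) ->
    forall k, k \in P -> u k = 0.
  move=> H k kP; have := H k; rewrite kP (bigD1 k) //= big1 ?addr0.
    by rewrite mxE kP eqxx mul1r.
  by move=> l; rewrite mxE kP eq_sym => /negbTE ->; rewrite mul0r.
(* Membership in the row space is tested against each column of the cokernel, a kernel vector of
   [A]. *)
have bA : (b <= A)%MS.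
  rewrite submxE; apply/eqP/matrixP => i j; rewrite !mxE.
  pose u k := cokermx A k j.
  have Au k : \sum_l A k l * u l = 0.
    by have /matrixP/(_ k j) := mulmx_coker A; rewrite !mxE.
  have u0 : forall k, k \in P -> u k = 0.
    by apply: AP => k; rewrite Au if_same.
  have uh : is_pressure adj P (fun=> 0) (fun=> 0) kappa u.
    split=> // k kP; have := AE u u0 k.
    by rewrite Au (negbTE kP).
  transitivity (\sum_k u k * \sum_(l | adj k l) X k l).
    apply: eq_bigr => k _; rewrite mxE; case: ifPn => kP.
      by rewrite mul0r (u0 _ kP) mul0r.
    by rewrite Xd // mulrC.
  rewrite sum_by_parts //; apply: big1 => e /edge_adj ee.
  have /eqP := harmonic_flow_eq0 net uh ee.
  by rewrite mulf_eq0 => /orP[/eqP->|/eqP/Xk ->//]; rewrite ?mul0r ?mulr0.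
(* The row solution [x] also solves the column system, by symmetry of [A]. *)
have /submxP[x bx] := bA.
pose u k := x 0 k.
have Au k : \sum_l A k l * u l = if k \in P then 0 else q k.
  have /matrixP/(_ 0 k) := bx; rewrite !mxE => ->.
  by apply: eq_bigr => l _; rewrite -{1}Asym mxE mulrC.
have u0 : forall k, k \in P -> u k = 0.
  by apply: AP => k; rewrite Au; case: ifP.
exists u; split=> // k kP.
by have := Au k; rewrite AE // (negbTE kP).
Qed.

End Flows.

(** * Thomson's principle for constant boundary pressure *)

Section ConstantPressure.

Context {R : realType} {V : nat}.
Context (adj : rel 'I_V) (adj_sym : symmetric adj) (adj_irr : irreflexive adj).
Context (P : {set 'I_V}) (pbar : 'I_V -> R) (c : R).
Context (pbarE : forall k, k \in P -> pbar k = c).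

Implicit Types (kappa X C Q d : 'M[R]_V) (q p u : 'I_V -> R).

(** Raising the zero-boundary solution by [c] meets the prescribed pressures without changing any
    pressure difference. *)
Lemma flow_physical q kappa X :
  is_network adj kappa -> is_flow adj P q X ->
  (forall k l, adj k l -> kappa k l = 0 -> X k l = 0) ->
  is_physical adj P pbar q kappa.
Proof.
move=> net Xf Xk.
have [u [u0 uq]] := dirichlet_solvable adj_sym adj_irr net Xf Xk.
set p := fun k => c + u k.
exists (\matrix_(k, l) if adj k l then (p k - p l) * kappa k l else 0); split.
  exists p => //; split=> k kP; first by rewrite /p u0 // addr0 pbarE.
  by rewrite -uq //; apply: eq_bigr => l _; rewrite /p; ring.
move=> Y Yk; apply: (kirchhoff_unique adj_sym adj_irr net) Yk.
exists p => //; split=> k kP; first by rewrite /p u0 // addr0 pbarE.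
by rewrite -uq //; apply: eq_bigr => l _; rewrite /p; ring.
Qed.

(** The cross term between [Q] and [X - Q] vanishes: [X - Q] has no sources outside [P], and [p - c]
    is zero on [P]. *)
Lemma thomson q kappa Q X :
  is_network adj kappa -> is_kirchhoff_flow adj P pbar q kappa Q ->
  is_flow adj P q X ->
  (forall k l, adj k l -> kappa k l = 0 -> X k l = 0) ->
  dissipation adj kappa Q <= dissipation adj kappa X.
Proof.
move=> net Qk Xf Xk.
have [Qa Qs Qd] := kirchhoff_is_flow adj_sym net Qk.
have [Xa Xs Xd] := Xf; case: Qk => p [pb pq] QE.
have E : \sum_(e | edge adj e)
    ((p e.1 - c) - (p e.2 - c)) * (X - Q) e.1 e.2 = 0.
  rewrite -(sum_by_parts adj_sym adj_irr (fun k => p k - c)); last first.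
    by move=> k l _; rewrite !mxE Xa Qa opprD.
  apply: big1 => k _; have [kP|kP] := boolP (k \in P).
    by rewrite pb // pbarE // subrr mul0r.
  under eq_bigr do rewrite !mxE.
  by rewrite sumrB Xd // Qd // subrr mulr0.
(* Adding twice the vanishing cross term completes the square, so the comparison holds edge by
   edge. *)
rewrite !dissipationE -[leLHS]addr0 -[X in _ + X](mul0r 2%:R) -[X in X * _]E.
rewrite mulr_suml -big_split /=.
apply: ler_sum => -[k l] /edge_adj /= kl.
have [_ k0] := net _ _ kl.
have Qkl : Q k l = (p k - p l) * kappa k l by rewrite QE mxE kl.
rewrite !mxE; have [k00|kn0] := eqVneq (kappa k l) 0.
  by rewrite Qkl (Xk _ _ kl k00) k00 !mulr0 subrr mulr0 mul0r addr0.
rewrite -subr_ge0.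
suff -> : X k l ^+ 2 / kappa k l - (Q k l ^+ 2 / kappa k l +
    (p k - c - (p l - c)) * (X k l - Q k l) * 2%:R)
    = (X k l - Q k l) ^+ 2 / kappa k l by rewrite divr_ge0 // sqr_ge0.
by rewrite Qkl; field.
Qed.

End ConstantPressure.

(** * Optimal conductances for a given flow *)

Section Murray.

Context {R : realType} {V : nat} (adj : rel 'I_V) (d : 'M[R]_V).
Context (d_sym : forall k l, adj k l -> d k l = d l k).
Context (d_gt0 : forall k l, adj k l -> 0 < d k l).

Implicit Types (kappa X : 'M[R]_V) (m K : R).

(** With the cube root as variable, cost, conductance and dissipation involve only integer powers,
    within reach of [field]. *)
Definition flow_root X k l : R := (`|X k l| * d k l) `^ 3^-1.

Definition flow_cost X : R :=
  \sum_(e | edge adj e) flow_root X e.1 e.2 ^+ 2.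

(** The squared factor is the square root of the conductance; the scale [m] is left free to fit the
    material constraint. *)
Definition murray m X : 'M[R]_V :=
  \matrix_(k, l) (m * flow_root X k l ^+ 2 / d k l) ^+ 2.

Lemma flow_root_ge0 X k l : 0 <= flow_root X k l.
Proof. exact: powR_ge0. Qed.

Lemma flow_root_cube X k l : adj k l -> flow_root X k l ^+ 3 = `|X k l| * d k l.
Proof.
move=> /d_gt0/ltW d0; rewrite -powR_mulrn ?flow_root_ge0 // -powRrM mulVf //.
by rewrite powRr1 // mulr_ge0.
Qed.

Lemma flow_root_eq0 X k l : adj k l -> (flow_root X k l == 0) = (X k l == 0).
Proof.
move=> kl; transitivity (flow_root X k l ^+ 3 == 0); first by rewrite expf_eq0.
rewrite flow_root_cube //.
by rewrite mulf_eq0 normr_eq0 (gt_eqF (d_gt0 kl)) orbF.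
Qed.

Lemma sqr_flow X k l : adj k l ->
  X k l ^+ 2 = flow_root X k l ^+ 6 / d k l ^+ 2.
Proof.
move=> kl; rewrite -real_normK ?num_real // (exprM _ 3 2) flow_root_cube //.
by rewrite exprMn mulfK // expf_neq0 // gt_eqF // d_gt0.
Qed.

Lemma murray_network m X :
  (forall k l, X l k = - X k l) -> is_network adj (murray m X).
Proof.
move=> Xa k l kl; rewrite !mxE sqr_ge0; split=> //.
by rewrite /flow_root Xa normrN (d_sym kl).
Qed.

Lemma murray_eq0 m X k l :
  0 < m -> adj k l -> murray m X k l = 0 -> X k l = 0.
Proof.
move=> m0 kl /eqP; rewrite mxE expf_eq0 /= !mulf_eq0 invr_eq0.
rewrite (gt_eqF m0) (gt_eqF (d_gt0 kl)) orbF orbb flow_root_eq0 //.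
exact: eqP.
Qed.

Lemma murray_powR m X k l : adj k l ->
  murray m X k l = m ^+ 2 * `|X k l| `^ (4 / 3) / d k l `^ (2 / 3).
Proof.
move=> kl; have d0 := d_gt0 kl.
have pow4 (x : R) : x `^ (4 / 3) = (x `^ 3^-1) ^+ 4.
  by rewrite -powR_mulrn ?powR_ge0 // -powRrM mulrC.
have pow2 (x : R) : x `^ (2 / 3) = (x `^ 3^-1) ^+ 2.
  by rewrite -powR_mulrn ?powR_ge0 // -powRrM mulrC.
(* Writing [d] as a cube lets [field] cancel it against its fractional powers. *)
have dE : d k l = (d k l `^ 3^-1) ^+ 3.
  by rewrite -powR_mulrn ?powR_ge0 // -powRrM mulVf // powRr1 // ltW.
rewrite mxE /flow_root powRM ?(ltW d0) // pow4 pow2 [X in _ / X]dE.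
by field; rewrite gt_eqF // powR_gt0.
Qed.

Lemma sqrt_murray m X k l : 0 <= m -> adj k l ->
  Num.sqrt (murray m X k l) = m * flow_root X k l ^+ 2 / d k l.
Proof.
move=> m0 kl; rewrite mxE sqrtr_sqr ger0_norm //.
by rewrite divr_ge0 ?mulr_ge0 ?flow_root_ge0 // ltW // d_gt0.
Qed.

Lemma material_murray m X : 0 <= m ->
  material adj d (murray m X) = m * flow_cost X.
Proof.
move=> m0; rewrite materialE mulr_sumr; apply: eq_bigr => e /edge_adj ee.
by rewrite sqrt_murray // divfK // gt_eqF // d_gt0.
Qed.

Lemma dissipation_murray m X : 0 < m ->
  dissipation adj (murray m X) X = flow_cost X / m ^+ 2.
Proof.
move=> m0; rewrite dissipationE mulr_suml.
apply: eq_bigr => -[k l] /edge_adj /= kl.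
rewrite sqr_flow // mxE.
(* Without flow the conductance is 0 too, and the quotient is 0 by convention. *)
have [->|r0] := eqVneq (flow_root X k l) 0; first by rewrite !expr0n !mul0r.
by field; rewrite r0 !gt_eqF // d_gt0.
Qed.

Lemma flow_cost_gt0 X k l : symmetric adj -> irreflexive adj ->
  (forall k l, X l k = - X k l) -> adj k l -> X k l != 0 -> 0 < flow_cost X.
Proof.
move=> adj_sym adj_irr Xa kl Xkl.
have [e ee Xe] : exists2 e, edge adj e & X e.1 e.2 != 0.
  have [?|?] := adj_edge adj_sym adj_irr kl; first by exists (k, l).
  by exists (l, k) => //=; rewrite Xa oppr_eq0.
rewrite /flow_cost (bigD1 e) //= ltr_wpDr ?sumr_ge0 // => [i _|].
  exact: sqr_ge0.
by rewrite exprn_gt0 // lt_def flow_root_ge0 flow_root_eq0 ?Xe // edge_adj.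
Qed.

(* With x the square root of the conductance and y its Murray value, both give
   the same material, and the dissipation compares through
   y^3 / x^2 >= 3 y - 2 x, that is, (y - x)^2 (y + 2 x) >= 0. *)
Lemma murray_optimal kappa X m : 0 < m ->
  (forall k l, X l k = - X k l) -> symmetric adj -> irreflexive adj ->
  is_network adj kappa ->
  (forall k l, adj k l -> kappa k l = 0 -> X k l = 0) ->
  material adj d kappa = m * flow_cost X ->
  dissipation adj kappa X <= flow_cost X / m ^+ 2 ->
  forall k l, adj k l -> kappa k l = murray m X k l.
Proof.
move=> m0 Xa adj_sym adj_irr net Xk mat le_diss.
pose x e := Num.sqrt (kappa e.1 e.2).
pose y e := Num.sqrt (murray m X e.1 e.2).
(* Dissipation on an edge minus its lower bound. As both networks use the same material, the bounds
   add up to [flow_cost X / m ^+ 2], so the gaps have sum at most 0. *)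
pose gap e := X e.1 e.2 ^+ 2 / kappa e.1 e.2 -
              m ^- 3 * (3%:R * (y e * d e.1 e.2) - 2%:R * (x e * d e.1 e.2)).
have gapE e : edge adj e -> (gap e = 0 /\ x e = y e) \/
    (0 < x e /\ gap e = m ^- 3 * d e.1 e.2 *
      ((y e - x e) ^+ 2 * (y e + 2%:R * x e)) / x e ^+ 2).
  move: e => [k l] /edge_adj /= kl; have [_ k0] := net _ _ kl.
  rewrite /gap /x /y /=.
  have [k00|kn0] := eqVneq (kappa k l) 0.
    left; have X0 := Xk _ _ kl k00.
    have -> : murray m X k l = 0.
      have /eqP r0 : flow_root X k l == 0 by rewrite flow_root_eq0 // X0.
      by rewrite mxE r0 expr0n mulr0 mul0r expr0n.
    by rewrite X0 k00 sqrtr0 !mul0r expr0n mul0r !mulr0 subrr mulr0 subrr.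
  have s0 : 0 < Num.sqrt (kappa k l) by rewrite sqrtr_gt0 lt_def kn0.
  right; split=> //.
  rewrite sqr_flow // sqrt_murray ?ltW // -{1}(sqr_sqrtr k0).
  by field; rewrite !gt_eqF // d_gt0.
have gap_ge0 e : edge adj e -> 0 <= gap e.
  move=> ee; have [[-> _]//|[x0 ->]] := gapE e ee.
  have d0 := d_gt0 (edge_adj ee).
  have y0 : 0 <= y e by exact: sqrtr_ge0.
  apply: divr_ge0 (sqr_ge0 _); apply: mulr_ge0.
    by rewrite ltW // mulr_gt0 // invr_gt0 exprn_gt0.
  by rewrite mulr_ge0 ?sqr_ge0 // addr_ge0 // mulr_ge0 // ltW.
have gap_sum : \sum_(e | edge adj e) gap e = 0.
  apply/eqP; rewrite eq_le sumr_ge0 // andbT.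
  rewrite sumrB -mulr_sumr sumrB -!mulr_sumr -dissipationE -!materialE.
  rewrite mat material_murray ?(ltW m0) // subr_le0 (le_trans le_diss) //.
  by rewrite le_eqVlt; apply/orP; left; apply/eqP; field; rewrite gt_eqF.
have edge_eq e : edge adj e -> kappa e.1 e.2 = murray m X e.1 e.2.
  move=> ee; have /edge_adj/net[_ k0] := ee.
  suff xy : x e = y e.
    rewrite -(sqr_sqrtr k0) -[RHS]sqr_sqrtr; last by rewrite mxE sqr_ge0.
    by congr (_ ^+ 2).
  have := psumr_eq0P gap_ge0 gap_sum ee.
  have [[_ ->]//|[x0 ->]] := gapE e ee.
  have [-> //|/eqP yx] := eqVneq (y e) (x e).
  have d0 := d_gt0 (edge_adj ee).
  have yx0 : 0 < y e + 2%:R * x e.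
    by rewrite ltr_wpDl ?sqrtr_ge0 // mulr_gt0.
  move/eqP; rewrite gt_eqF //; apply: divr_gt0; last exact: exprn_gt0.
  apply: mulr_gt0; first by rewrite mulr_gt0 // invr_gt0 exprn_gt0.
  by rewrite mulr_gt0 // lt_def sqr_ge0 expf_neq0 // subr_eq0; apply/eqP.
move=> k l kl; have [/edge_eq //|/edge_eq /= lk] := adj_edge adj_sym adj_irr kl.
have [-> _] := net _ _ kl.
by rewrite lk; have [] := murray_network m Xa kl.
Qed.

End Murray.

(** * Strict concavity of the flow cost *)

Section Concavity.

Context {R : realType} {V : nat} (adj : rel 'I_V) (d : 'M[R]_V).
Context (d_gt0 : forall k l, adj k l -> 0 < d k l).

Implicit Types (X C : 'M[R]_V).

(** A perturbation dominated by [a] cannot reverse its sign, so the absolute value is linear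
    here. *)
Lemma norm_add_sub (a b : R) : `|b| <= `|a| ->
  `|a + b| + `|a - b| = 2%:R * `|a|.
Proof.
by have [?|?] := ger0P a; have [?|?] := ger0P b; have [?|?] := ger0P (a + b);
  have [?|?] := ger0P (a - b); lra.
Qed.

(* The tangent inequality 3 u^2 r <= 2 u^3 + r^3, summed over u = r+ and r-,
   where the cubes of r+ and r- add up to 2 r^3. *)
Lemma flow_root_concave X C k l : adj k l -> `|C k l| <= `|X k l| ->
  0 <= 2%:R * flow_root d X k l ^+ 2
       - (flow_root d (X + C) k l ^+ 2 + flow_root d (X - C) k l ^+ 2)
    ?= iff (C k l == 0).
Proof.
move=> kl CX; set r := flow_root d X k l.
set a := flow_root d (X + C) k l; set b := flow_root d (X - C) k l.
have [r0 a0 b0] : [/\ 0 <= r, 0 <= a & 0 <= b] by split; exact: powR_ge0.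
have cubes : a ^+ 3 + b ^+ 3 = 2%:R * r ^+ 3.
  rewrite !(flow_root_cube d_gt0) // !mxE -mulrDl norm_add_sub //; ring.
have [C0|C0] := eqVneq (C k l) 0.
  have -> : a = r by rewrite /a /r /flow_root !mxE C0 addr0.
  have -> : b = r by rewrite /b /r /flow_root !mxE C0 subr0.
  by rewrite -mulr2n mulr_natl subrr; split; rewrite ?eqxx.
have r_gt0 : 0 < r.
  rewrite lt_def r0 (flow_root_eq0 d_gt0) // andbT -normr_gt0.
  rewrite (lt_le_trans _ CX) //.
  by rewrite normr_gt0.
(* If both roots equalled [r], then [X + C], [X - C] and [X] would have the same absolute value on
   this edge, forcing [C] to vanish there. *)
have ab : (a != r) || (b != r).
  rewrite -negb_and; apply/negP => /andP[/eqP ar /eqP br].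
  have dkl := d_gt0 kl.
  have := flow_root_cube d_gt0 (X + C) kl.
  rewrite -/a ar /r (flow_root_cube d_gt0) // !mxE.
  move/(mulIf (lt0r_neq0 dkl)) => nD.
  have := flow_root_cube d_gt0 (X - C) kl.
  rewrite -/b br /r (flow_root_cube d_gt0) // !mxE.
  move/(mulIf (lt0r_neq0 dkl)) => nB.
  move: C0 nD nB.
  by have [?|?] := ger0P (X k l); have [?|?] := ger0P (X k l + C k l);
    have [?|?] := ger0P (X k l - C k l) => /eqP; lra.
have tangent u : 2%:R * u ^+ 3 + r ^+ 3 - 3%:R * u ^+ 2 * r =
    (u - r) ^+ 2 * (2%:R * u + r) by ring.
have tangent_ge0 u : 0 <= u -> 0 <= (u - r) ^+ 2 * (2%:R * u + r).
  by move=> u0; rewrite mulr_ge0 ?sqr_ge0 // addr_ge0 // mulr_ge0.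
have tangent_gt0 u : 0 <= u -> u != r -> 0 < (u - r) ^+ 2 * (2%:R * u + r).
  move=> u0 ur; rewrite mulr_gt0 //; last by rewrite ltr_wpDl // mulr_ge0.
  by rewrite lt_def sqr_ge0 expf_neq0 // subr_eq0.
suff H : 0 < 2%:R * r ^+ 2 - (a ^+ 2 + b ^+ 2).
  by split; [exact: ltW|rewrite lt_eqF].
(* Multiplied by [3 * r], the second difference is the sum of the two tangent gaps, thanks to
   [cubes]. *)
rewrite -(pmulr_rgt0 _ (mulr_gt0 (ltr0Sn R 2) r_gt0)).
have -> : 3%:R * r * (2%:R * r ^+ 2 - (a ^+ 2 + b ^+ 2)) =
   (a - r) ^+ 2 * (2%:R * a + r) + (b - r) ^+ 2 * (2%:R * b + r).
  rewrite -!tangent.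
  have -> : 2%:R * a ^+ 3 + r ^+ 3 - 3%:R * a ^+ 2 * r +
    (2%:R * b ^+ 3 + r ^+ 3 - 3%:R * b ^+ 2 * r) =
    2%:R * (a ^+ 3 + b ^+ 3) + 2%:R * r ^+ 3
    - 3%:R * r * (a ^+ 2 + b ^+ 2) by ring.
  rewrite cubes; ring.
case/orP: ab => [ar|br].
  exact: ltr_wpDr (tangent_ge0 _ b0) (tangent_gt0 _ a0 ar).
exact: ltr_wpDl (tangent_ge0 _ a0) (tangent_gt0 _ b0 br).
Qed.

(** The edgewise second differences are nonnegative with sum at most 0; hence all are 0, and the
    equality case applies. *)
Lemma flow_cost_strictly_concave X C :
  (forall k l, adj k l -> `|C k l| <= `|X k l|) ->
  flow_cost adj d X <= flow_cost adj d (X + C) ->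
  flow_cost adj d X <= flow_cost adj d (X - C) ->
  forall e, edge adj e -> C e.1 e.2 = 0.
Proof.
move=> CX leD leB e ee.
pose gap e := 2%:R * flow_root d X e.1 e.2 ^+ 2
  - (flow_root d (X + C) e.1 e.2 ^+ 2 + flow_root d (X - C) e.1 e.2 ^+ 2).
have gapP i : edge adj i -> 0 <= gap i ?= iff (C i.1 i.2 == 0).
  by move=> /edge_adj ii; apply: flow_root_concave => //; exact: CX.
have gap_ge0 i : edge adj i -> 0 <= gap i by case/gapP.
have gap_sum : \sum_(i | edge adj i) gap i = 0.
  apply/eqP; rewrite eq_le sumr_ge0 // andbT sumrB -mulr_sumr big_split /=.
  by rewrite subr_le0 mulr_natl mulr2n lerD.
have := psumr_eq0P gap_ge0 gap_sum ee.
by move/esym/eqP; have [_ ->] := gapP _ ee => /eqP.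
Qed.

End Concavity.

(** * The minimizer as Murray's network of a cost-minimizing flow *)

Section Minimizer.

Context {R : realType} {V : nat}.
Context (adj : rel 'I_V) (adj_sym : symmetric adj) (adj_irr : irreflexive adj).
Context (d : 'M[R]_V) (d_sym : forall k l, adj k l -> d k l = d l k).
Context (d_gt0 : forall k l, adj k l -> 0 < d k l).
Context (P : {set 'I_V}) (pbar q : 'I_V -> R) (c : R).
Context (pbarE : forall k, k \in P -> pbar k = c).
Context (k0 : 'I_V) (k0P : k0 \notin P) (qk0 : q k0 != 0).
Context (K : R) (K_gt0 : 0 < K) (kappa Q : 'M[R]_V).
Context (kappa_min : is_minimizer adj P pbar q d K kappa).
Context (Q_flow : is_kirchhoff_flow adj P pbar q kappa Q).

Implicit Types (X C : 'M[R]_V).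

(** The nonzero inflow at [k0] must leave through some edge; this makes the scale
    [K / flow_cost adj d X] positive. *)
Lemma flow_cost_pos X : is_flow adj P q X -> 0 < flow_cost adj d X.
Proof.
move=> [Xa _ Xd].
have [/existsP[l /andP[kl Xl]]|/existsPn X0] :=
    boolP [exists l, adj k0 l && (X k0 l != 0)].
  exact: (flow_cost_gt0 d_gt0 adj_sym adj_irr Xa kl Xl).
have := qk0; rewrite -Xd // big1 ?eqxx // => l kl.
by have := X0 l; rewrite kl negbK => /eqP.
Qed.

(** The competitor is Murray's network of [X], scaled to use material [K]. Its own Kirchhoff flow
    dissipates at most as much as [X]. *)
Lemma minimizer_dissipation_le X : is_flow adj P q X ->
  dissipation adj kappa Q <=
    flow_cost adj d X / (K / flow_cost adj d X) ^+ 2.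
Proof.
move=> Xf; have fX := flow_cost_pos Xf; have [Xa _ _] := Xf.
set m := K / flow_cost adj d X; have m0 : 0 < m by rewrite divr_gt0.
have net := murray_network d_sym m Xa.
have Xk k l : adj k l -> murray d m X k l = 0 -> X k l = 0.
  exact: murray_eq0.
have phys := flow_physical adj_sym adj_irr pbarE net Xf Xk.
have [Q' [Q'f _]] := phys.
rewrite -dissipation_murray //.
apply: le_trans (thomson adj_sym adj_irr pbarE net Q'f Xf Xk).
have [_ min] := kappa_min; apply: min => //; split=> //.
by rewrite material_murray ?(ltW m0) // divfK // gt_eqF.
Qed.

Lemma minimizer_network : is_network adj kappa.
Proof. by have [[]] := kappa_min. Qed.

Lemma minimizer_flow : is_flow adj P q Q.
Proof. exact: kirchhoff_is_flow minimizer_network Q_flow. Qed.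

(** The preceding bound at [X = Q] supplies the inequality whose equality case characterizes
    Murray's conductances. *)
Lemma minimizer_murray k l : adj k l ->
  kappa k l = murray d (K / flow_cost adj d Q) Q k l.
Proof.
have Qf := minimizer_flow; have [Qa _ _] := Qf; have fQ := flow_cost_pos Qf.
have [[_ _ mat] _] := kappa_min.
move: k l; apply: murray_optimal => //.
- exact: divr_gt0.
- exact: minimizer_network.
- by move=> k l kl kap0; case: Q_flow => p _ ->; rewrite mxE kl kap0 mulr0.
- by rewrite mat divfK // gt_eqF.
- exact: minimizer_dissipation_le.
Qed.

(** Both sides of the dissipation bound are cubes of costs over [K ^+ 2], and cubing is monotone. *)
Lemma minimizer_flow_cost X : is_flow adj P q X ->
  flow_cost adj d Q <= flow_cost adj d X.
Proof.
move=> Xf; have fX := flow_cost_pos Xf; have fQ := flow_cost_pos minimizer_flow.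
have := minimizer_dissipation_le Xf.
have -> : dissipation adj kappa Q =
    dissipation adj (murray d (K / flow_cost adj d Q) Q) Q.
  rewrite !dissipationE; apply: eq_bigr => e /edge_adj/minimizer_murray -> //.
rewrite dissipation_murray ?divr_gt0 //.
have cubeE (f : R) : 0 < f -> f / (K / f) ^+ 2 = f ^+ 3 / K ^+ 2.
  by move=> f0; field; rewrite !gt_eqF.
by rewrite !cubeE // ler_pM2r ?invr_gt0 ?exprn_gt0 // ler_pXn2r // nnegrE ltW.
Qed.

Lemma conducting_flow_neq0 k l : conducts adj kappa k l -> Q k l != 0.
Proof.
move=> /andP[kl]; rewrite minimizer_murray //; apply: contraTneq => Q0.
have /eqP r0 : flow_root d Q k l == 0 by rewrite (flow_root_eq0 d_gt0) // Q0.
by rewrite mxE r0 expr0n mulr0 mul0r expr0n ltxx.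
Qed.

(* A nonzero circulation C could be added to and subtracted from Q, and the
   strictly concave cost would decrease in one of the two directions.  Dividing
   it by a bound S on the ratios |C| / |Q| keeps it dominated by Q. *)
Lemma no_conducting_circulation C : is_flow adj P (fun=> 0) C ->
  (forall k l, ~~ conducts adj kappa k l -> C k l = 0) -> C = 0.
Proof.
move=> Cf Ck; have [Ca Cs _] := Cf.
(* The summand 1 keeps [S] positive even when [C = 0]. *)
pose S := 1 + \sum_k \sum_l `|C k l| / `|Q k l|.
have ratio_ge0 k l : 0 <= `|C k l| / `|Q k l| by rewrite divr_ge0.
have S_gt0 : 0 < S.
  by rewrite ltr_wpDr ?ltr01 // sumr_ge0 // => k _; exact: sumr_ge0.
have ratio_le k l : `|C k l| / `|Q k l| <= S.
  rewrite /S (bigD1 k) //= (bigD1 l) //= addrCA -addrA lerDl.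
  rewrite addr_ge0 // ?addr_ge0 //; first exact: sumr_ge0.
  by rewrite sumr_ge0 // => i _; exact: sumr_ge0.
have dom k l : adj k l -> `|(S^-1 *: C) k l| <= `|Q k l|.
  move=> _; rewrite mxE normrM gtr0_norm ?invr_gt0 // mulrC ler_pdivrMr //.
  have [kl|/Ck ->] := boolP (conducts adj kappa k l); last first.
    by rewrite normr0 mulr_ge0 // ltW.
  rewrite mulrC -ler_pdivrMr ?ratio_le // normr_gt0.
  exact: conducting_flow_neq0.
have Qf := minimizer_flow.
have C0 := flow_cost_strictly_concave d_gt0 dom
  (minimizer_flow_cost (flow_perturb _ Qf Cf)).
have edge0 e : edge adj e -> C e.1 e.2 = 0.
  move=> ee; have : (S^-1 *: C) e.1 e.2 = 0.
    apply: C0 ee; rewrite -scaleNr; apply: minimizer_flow_cost.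
    exact: flow_perturb.
  by move/eqP; rewrite mxE mulf_eq0 invr_eq0 (gt_eqF S_gt0) => /eqP.
apply/matrixP => k l; rewrite mxE.
have [kl|/Cs //] := boolP (adj k l).
have [/edge0 //|/edge0 /= lk] := adj_edge adj_sym adj_irr kl.
by rewrite Ca lk oppr0.
Qed.

End Minimizer.

(** * Unit flows along walks *)

Section PathFlow.

Context {R : realType} {V : nat}.

(** The unit current along the walk [x :: s]; opposite traversals of an edge cancel. *)
Fixpoint path_flow (x : 'I_V) (s : seq 'I_V) : 'M[R]_V :=
  if s is y :: s' then delta_mx x y - delta_mx y x + path_flow y s' else 0.

Lemma path_flow_anti x s k l : path_flow x s l k = - path_flow x s k l.
Proof.
elim: s x => [|y s IH] x /=; first by rewrite !mxE oppr0.
rewrite !mxE IH ![(l == _) && _]andbC; ring.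
Qed.

Lemma path_flow_supp (e : rel 'I_V) x s k l :
  symmetric e -> path e x s -> ~~ e k l -> path_flow x s k l = 0.
Proof.
move=> e_sym; elim: s x => [|y s IH] x /=; first by rewrite mxE.
move=> /andP[xy ys] nkl; rewrite !mxE IH // addr0.
case: andP => [[/eqP kx /eqP ly]|_]; first by rewrite kx ly xy in nkl.
case: andP => [[/eqP ky /eqP lx]|_]; last exact: subrr.
by rewrite ky lx e_sym xy in nkl.
Qed.

(** Telescoping leaves a unit source at the start and a unit sink at the end. *)
Lemma path_flow_sum x s k :
  \sum_l path_flow x s k l = (k == x)%:R - (k == last x s)%:R.
Proof.
elim: s x => [|y s IH] x /=.
  by rewrite subrr big1 // => l _; rewrite mxE.
have delta_sum (a b : 'I_V) : \sum_l (delta_mx a b : 'M[R]_V) k l = (k == a)%:R.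
  rewrite (bigD1 b) //= big1 ?addr0; first by rewrite mxE eqxx andbT.
  by move=> l /negbTE lb; rewrite mxE lb andbF.
transitivity (\sum_l ((delta_mx x y : 'M[R]_V) k l
    - (delta_mx y x : 'M[R]_V) k l + path_flow y s k l)).
  by apply: eq_bigr => l _; rewrite !mxE.
by rewrite big_split /= sumrB !delta_sum IH addrA subrK.
Qed.

Lemma path_flow_notin x s k l : k \notin x :: s -> path_flow x s k l = 0.
Proof.
elim: s x => [|y s IH] x /=; first by rewrite mxE.
rewrite inE negb_or => /andP[/negbTE kx kys]; rewrite !mxE IH // kx.
by move: kys; rewrite inE negb_or => /andP[/negbTE -> _]; rewrite subrr addr0.
Qed.

Lemma path_flow_rcons x s z : path_flow x (rcons s z) =
  path_flow x s + (delta_mx (last x s) z - delta_mx z (last x s)).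
Proof.
elim: s x => [|y s IH] x /=; first by rewrite addr0 add0r.
by rewrite IH addrA.
Qed.

(** The condition on the ends covers closed walks and walks between two vertices of [P] alike. *)
Lemma path_flow_is_flow (adj : rel 'I_V) (P : {set 'I_V}) x s :
  symmetric adj -> path adj x s ->
  (forall k, k \notin P -> (k == x) = (k == last x s)) ->
  is_flow adj P (fun=> 0) (path_flow x s).
Proof.
move=> adj_sym xs ends; split=> [k l|k l|k kP].
- exact: path_flow_anti.
- exact: path_flow_supp.
- rewrite big_mkcond /= -[RHS](subrr ((k == x)%:R : R)) {2}ends //.
  rewrite -path_flow_sum; apply: eq_bigr => l _.
  by case: ifPn => // /(path_flow_supp adj_sym xs) ->.
Qed.

End PathFlow.

(** * Murray's law, and exclusion of loops and pressure paths *)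

Theorem corollary3p8 (R : realType) (V : nat)
    (adj : rel 'I_V) (adj_sym : symmetric adj) (adj_irr : irreflexive adj)
    (d : 'M[R]_V)
    (d_sym : forall k l, adj k l -> d k l = d l k)
    (d_gt0 : forall k l, adj k l -> 0 < d k l)
    (P F : {set 'I_V}) (PF_disj : [disjoint P & F])
    (pbar q : 'I_V -> R)
    (q_eq0 : forall k, k \notin P :|: F -> q k = 0)
    (q_nontrivial : exists2 k, k \in F & q k != 0)
    (pbar_const : forall k l, k \in P -> l \in P -> pbar k = pbar l)
    (K : R) (K_gt0 : 0 < K)
    (kappa Q : 'M[R]_V)
    (kappa_min : is_minimizer adj P pbar q d K kappa)
    (Q_flow : is_kirchhoff_flow adj P pbar q kappa Q) :
  [/\ exists2 a : R, 0 < a &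
        forall k l, adj k l ->
          kappa k l = a * `|Q k l| `^ (4 / 3) / d k l `^ (2 / 3),
      ~ (exists s : seq 'I_V, is_loop adj kappa s)
    & ~ (exists k l : 'I_V, exists s : seq 'I_V,
           [/\ k \in P, l \in P & is_path adj kappa k l s])].
Proof.
have [k0 k0F qk0] := q_nontrivial.
have k0P : k0 \notin P by rewrite (disjointFl PF_disj).
have [c pbarE] : exists c, forall k, k \in P -> pbar k = c.
  have [->|[k1 k1P]] := set_0Vmem P.
    by exists 0 => k; rewrite inE.
  by exists (pbar k1) => k kP; exact: pbar_const.
have net := minimizer_network kappa_min.
have cond_sym : symmetric (conducts adj kappa).
  move=> k l; rewrite /conducts adj_sym.
  by have [lk|] := boolP (adj l k) => //=; have [-> _] := net _ _ lk.
have no_circ x s :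
    path (conducts adj kappa) x s ->
    (forall k, k \notin P -> (k == x) = (k == last x s)) ->
    path_flow x s = 0 :> 'M[R]_V.
  move=> xs ends.
  apply: (no_conducting_circulation adj_sym adj_irr d_sym d_gt0 pbarE k0P qk0
    K_gt0 kappa_min Q_flow); last by move=> k l; exact: path_flow_supp.
  apply: path_flow_is_flow => //; apply: sub_path xs => k l.
  by case/andP.
split.
- have Qf := minimizer_flow adj_sym kappa_min Q_flow.
  have fQ := flow_cost_pos adj_sym adj_irr d_gt0 k0P qk0 Qf.
  exists ((K / flow_cost adj d Q) ^+ 2); first by rewrite exprn_gt0 // divr_gt0.
  move=> k l kl; rewrite -(murray_powR d_gt0) //.
  exact: (minimizer_murray adj_sym adj_irr d_sym d_gt0 pbarE k0P qk0
    K_gt0 kappa_min Q_flow).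
- move=> [s0 /and3P[]]; case: s0 => [|x [|y [|z s]]] // xs _ cyc.
  (* Closing the loop at [x] gives a circulation, contradicted by its entry at [(x, y)], which is
     1. *)
  have := no_circ x (rcons [:: y, z & s] x) cyc.
  rewrite last_rcons => /(_ (fun _ _ => erefl)).
  rewrite path_flow_rcons /= => /matrixP/(_ x y).
  move: xs; rewrite /= inE negb_or => /and3P[/andP[xy xs] yzs _].
  (* Three vertices matter here: in a two-vertex cycle the closing step would run from [y] back to
     [x] and cancel the first. *)
  have ylast : y != last z s.
    by apply: contraNneq yzs => ->; exact: mem_last.
  have /negbTE xz : x != z by move: xs; rewrite inE negb_or => /andP[].
  rewrite !mxE !eqxx path_flow_notin // (negbTE xy) xz (negbTE ylast).
  rewrite (eq_sym y x) (negbTE xy) !andbF /= !subr0 !addr0 => /eqP.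
  by rewrite oner_eq0.
- move=> [k [l [[|x s]]]] [kP lP] /and4P[kl] //=; first by rewrite (negbTE kl).
  move=> /andP[ks _] xs /eqP lst.
  have := no_circ k (x :: s) xs.
  (* Both ends lie in [P], so a vertex outside [P] equals neither. *)
  have ends i : i \notin P -> (i == k) = (i == last k (x :: s)).
    rewrite /= lst => iP; apply/idP/idP => /eqP ii; by rewrite ii ?kP ?lP in iP.
  move=> /(_ ends) /= /matrixP/(_ k x); rewrite !mxE !eqxx path_flow_notin //.
  move: ks; rewrite inE negb_or => /andP[/negbTE -> _].
  by rewrite subr0 addr0 => /eqP; rewrite oner_eq0.
Qed.
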